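(* Let $k$ be an algebraically closed field of positive characteristic $p>0$. For a power $q=p^h$ of $p$, let $R=W(k)[\zeta_q]$ be the Witt ring of $k$ with a primitive $q$-th root of unity adjoined. Consider the group $G=C_q\rtimes C_m$, where $C_m$ and $C_q$ are cyclic groups of orders $m$ and $q$ respectively and $(m,p)=1$. Assume that $\sigma$ and $\tau$ are generators of $C_m$ and $C_q$ respectively and that $\sigma\tau\sigma^{-1}=\tau^a$ for some integer $a$ (which should satisfy $a^m\equiv 1 \bmod q$). Then there are selections of $m,q$ for which there is a linear representation $\rho:G\to\mathrm{GL}_2(k)$ that cannot be lifted to a representation $\rho_R:G\to\mathrm{GL}_2(R)$.
   Context: $W(k)$ denotes the ring of Witt vectors of $k$; $R=W(k)[\zeta_q]$ is a local ring of characteristic zero with residue field $k$. A lift of $\rho:G\to\mathrm{GL}_2(k)$ to $R$ is a group homomorphism $\rho_R:G\to\mathrm{GL}_2(R)$ whose composition with the reduction map $\mathrm{GL}_2(R)\to\mathrm{GL}_2(k)$ is $\rho$.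
   Formalization: The formal statement assumes p > 3: for p = 2 and p = 3 the claim fails, because every representation of C_q ⋊ C_m into GL_2(k) lifts to R in those characteristics. *)

(* Defs.v *)
From HB Require Import structures.
From mathcomp Require Import all_boot all_order all_algebra.
From mathcomp Require Import all_fingroup all_solvable all_field all_character.
From mathcomp Require Import boolp.
From mathcomp Require Import finmap.
From mathcomp Require Import monalg.

Set Implicit Arguments.
Unset Strict Implicit.
Unset Printing Implicit Defensive.

Import GRing.Theory.
Local Open Scope ring_scope.

Local Notation zmalg V := {malg int[cmonom V]}.

Section IntegerPolynomials.
Variable V : choiceType.

Definition malg_var (v : V) : zmalg V := << ucm v >>.

Section Eval.
Variables (A : comNzRingType) (e : V -> A).

Definition mon_eval (m : cmonom V) : A := \prod_(v <- finsupp m) e v ^+ m v.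

Lemma mon_evalEw (d : {fset V}) (m : cmonom V) :
  (finsupp m `<=` d)%fset -> mon_eval m = \prod_(v <- d) e v ^+ m v.
Proof.
move=> le; apply: (big_fset_incl _ le) => v _.
by rewrite -cmE_eq0 => /eqP ->; rewrite expr0.
Qed.

Lemma mon_eval_mmorphism : mmorphism mon_eval.
Proof.
split=> [m1 m2|]; last by rewrite /mon_eval mdom1 big_seq_fset0.
rewrite (@mon_evalEw (finsupp m1 `|` finsupp m2)%fset) ?mdomD //.
rewrite (@mon_evalEw (finsupp m1 `|` finsupp m2)%fset m1) ?fsubsetUl //.
rewrite (@mon_evalEw (finsupp m1 `|` finsupp m2)%fset m2) ?fsubsetUr //.
by rewrite -big_split; apply: eq_bigr => v _; rewrite cmM exprD.
Qed.
HB.instance Definition _ := isMultiplicative.Build _ _ mon_eval mon_eval_mmorphism.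

Definition malg_eval : zmalg V -> A := mmap intr mon_eval.
HB.instance Definition _ := GRing.RMorphism.on malg_eval.

Lemma malg_eval_var v : malg_eval (malg_var v) = e v.
Proof.
by rewrite /malg_eval mmapU mul1r /= /mon_eval mdomU big_seq_fset1 cmUU expr1.
Qed.

End Eval.

Lemma malg_ind (P : zmalg V -> Prop) : P 1 -> (forall v, P (malg_var v)) ->
  (forall f g, P f -> P g -> P (f - g)) ->
  (forall f g, P f -> P g -> P (f * g)) -> forall f, P f.
Proof.
move=> P1 PX PB PM f; have P0: P 0 by rewrite -(subrr 1); exact: PB.
have PN g: P g -> P (- g) by move=> Pg; rewrite -sub0r; exact: PB.
have PD g1 g2: P g1 -> P g2 -> P (g1 + g2).
  by move=> P_1 P_2; rewrite -[g2]opprK; apply/PB/PN.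
have PU (m : cmonom V) : P << m >>.
  have [n lemn] := ubnP (mdeg m); elim: n m lemn => [|n IHn] m lemn.
    by exfalso; move: lemn; rewrite ltn0.
  have [->|m_neq1] := eqVneq m mone; first by rewrite -/malgC mpolyC1E.
  have /fset0Pn[v vm]: finsupp m != fset0.
    apply: contra m_neq1 => /eqP m0; apply/cmP => v.
    by rewrite cm1; apply/eqP; rewrite cmE_eq0 m0 inE.
  have Dm: m = mmul (ucm v) (divcm m (ucm v)).
    apply/eqP/cmP => w; rewrite cmM divcmE ucmE.
    case: eqP => [<-|_]; last by rewrite subn0.
    by rewrite subnKC // lt0n cmE_neq0.
  have ->: << m >> = malg_var v * << divcm m (ucm v) >> :> zmalg V.
    by rewrite malgM_def fgmulUU mulr1 -Dm.
  apply: PM; first exact: PX.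
  apply: IHn; move: lemn; have := congr1 (@mdeg V) Dm.
  by rewrite mdegM mdegU => ->; rewrite add1n ltnS.
have PMn (m : cmonom V) n : P (<< m >> *+ n).
  elim: n => [|n IHn]; first by rewrite mulr0n; exact: P0.
  by rewrite mulrS; apply: PD; [exact: PU | exact: IHn].
rewrite (monalgE f); elim: (enum_fset (msupp f)) => [|m s IHs].
  by rewrite big_nil; exact: P0.
rewrite big_cons; apply: PD; last exact: IHs.
have ->: << f@_m *g m >> = << m >> *~ f@_m :> zmalg V.
  by rewrite -raddfMz intz.
case: (f@_m) => n; last by rewrite NegzE mulrNz; apply: PN; exact: PMn.
exact: PMn.
Qed.

(* Coefficientwise Euclidean quotient; it is only used when m divides f. *)
Definition malg_div (m : nat) (f : zmalg V) : zmalg V := [malg k in msupp f => (f@_k %/ m)%Z].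

Lemma malg_divK m (f : zmalg V) : (0 < m)%N -> malg_div m (f *+ m) = f.
Proof.
move=> m_gt0; apply/malgP => k; rewrite mcoeffE mcoeffMn.
have ->: f@_k *+ m = f@_k * m%:Z by rewrite -mulr_natr natz.
rewrite mulzK -?lt0n //; case: ifPn => //.
rewrite -mcoeff_eq0 mcoeffMn Num.Theory.mulrn_eq0 -[m == 0%N]negbK -lt0n m_gt0 /=.
by move/eqP.
Qed.

End IntegerPolynomials.

(* The polynomial ring Z[V]: V generates it (ipr_ind), evaluation is free     *)
(* (ipr_eval), and it has no torsion (ipr_div is exact division by m != 0).   *)
Record int_poly_ring (V : choiceType) := IntPolyRing {
  ipr_sort :> comNzRingType;
  ipr_var : V -> ipr_sort;
  ipr_eval (A : comNzRingType) : (V -> A) -> {rmorphism ipr_sort -> A};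
  ipr_div : nat -> ipr_sort -> ipr_sort;
  ipr_eval_var (A : comNzRingType) (e : V -> A) v :
    ipr_eval e (ipr_var v) = e v;
  ipr_ind (P : ipr_sort -> Prop) : P 1 -> (forall v, P (ipr_var v)) ->
    (forall f g, P f -> P g -> P (f - g)) ->
    (forall f g, P f -> P g -> P (f * g)) -> forall f, P f;
  ipr_divK m f : (0 < m)%N -> ipr_div m (f *+ m) = f }.

(* Locked, to keep conversion from computing with explicit polynomials. *)
Fact zpoly_key : unit. Proof. exact: tt. Qed.
Definition zpoly (V : choiceType) : int_poly_ring V :=
  locked_with zpoly_key
    (@IntPolyRing V (zmalg V) (@malg_var V) (@malg_eval V) (@malg_div V)
      (@malg_eval_var V) (@malg_ind V) (@malg_divK V)).

Definition zvar (V : choiceType) : V -> zpoly V := @ipr_var V (zpoly V).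
Arguments zvar {V} v.
Definition zeval (V : choiceType) (A : comNzRingType) (e : V -> A) :
  {rmorphism zpoly V -> A} := ipr_eval (zpoly V) e.
Definition zdiv (V : choiceType) : nat -> zpoly V -> zpoly V :=
  @ipr_div V (zpoly V).

Lemma zeval_var (V : choiceType) (A : comNzRingType) (e : V -> A) v :
  zeval e (zvar v) = e v.
Proof. exact: ipr_eval_var. Qed.

Lemma zpoly_ind (V : choiceType) (P : zpoly V -> Prop) :
  P 1 -> (forall v, P (zvar v)) ->
  (forall f g, P f -> P g -> P (f - g)) ->
  (forall f g, P f -> P g -> P (f * g)) -> forall f, P f.
Proof. exact: ipr_ind. Qed.

Lemma zdivK (V : choiceType) m (f : zpoly V) :
  (0 < m)%N -> zdiv m (f *+ m) = f.
Proof. exact: ipr_divK. Qed.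

Section Cong.
Variable B : comNzRingType.
Implicit Types (a b c : B) (m n : nat).

(* a = b modulo the ideal m B. *)
Definition cong m a b := exists c, a - b = c *+ m.

Lemma cong_refl m a : cong m a a.
Proof. by exists 0; rewrite subrr mul0rn. Qed.

Lemma cong_trans m b a c : cong m a b -> cong m b c -> cong m a c.
Proof.
move=> [x Dx] [y Dy]; exists (x + y).
by rewrite mulrnDl -Dx -Dy addrA subrK.
Qed.

Lemma cong_sym m a b : cong m a b -> cong m b a.
Proof. by case=> x Dx; exists (- x); rewrite mulNrn -Dx opprB. Qed.

Lemma congD m a b a' b' : cong m a a' -> cong m b b' -> cong m (a + b) (a' + b').
Proof.
by move=> [x Dx] [y Dy]; exists (x + y); rewrite mulrnDl -Dx -Dy opprD addrACA.
Qed.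

Lemma congN m a b : cong m a b -> cong m (- a) (- b).
Proof. by case=> x Dx; exists (- x); rewrite mulNrn -Dx opprD. Qed.

Lemma congM m a b a' b' : cong m a a' -> cong m b b' -> cong m (a * b) (a' * b').
Proof.
move=> [x Dx] [y Dy]; exists (x * b + a' * y).
by rewrite mulrnDl -mulrnAl -mulrnAr -Dx -Dy mulrBl mulrBr addrA subrK.
Qed.

Lemma congX m n a b : cong m a b -> cong m (a ^+ n) (b ^+ n).
Proof.
move=> ab; elim: n => [|n IHn]; first exact: cong_refl.
by rewrite !exprS; apply: congM.
Qed.

Lemma cong_sum m (I : finType) (F G : I -> B) :
  (forall i, cong m (F i) (G i)) -> cong m (\sum_i F i) (\sum_i G i).
Proof.
move=> FG; apply: (big_ind2 (cong m)) => // [|a a' b b']; first exact: cong_refl.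
exact: congD.
Qed.

Lemma congMn m n a b : cong m a b -> cong (m * n) (a *+ n) (b *+ n).
Proof. by case=> x Dx; exists x; rewrite mulrnA -Dx mulrnBl. Qed.

Lemma cong_dvd m n a b : (m %| n)%N -> cong n a b -> cong m a b.
Proof. by case/dvdnP=> k -> [x Dx]; exists (x *+ k); rewrite -mulrnA. Qed.

Lemma cong_exp p k a b : cong p a b -> cong (p ^ k.+1) (a ^+ (p ^ k)) (b ^+ (p ^ k)).
Proof.
move=> ab; elim: k => [|k [c Dc]]; first by rewrite expn1 expn0 !expr1.
rewrite [X in _ ^+ X]expnSr [X in cong _ _ (_ ^+ X)]expnSr !exprM.
set x := a ^+ _ in Dc *; set y := b ^+ _ in Dc *.
have xy: cong p x y by apply: cong_dvd (ex_intro _ c Dc); rewrite expnS dvdn_mulr.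
have [d Dd]: cong p (\sum_(i < p) x ^+ (p.-1 - i) * y ^+ i) 0.
  apply: (@cong_trans _ (\sum_(i < p) y ^+ (p.-1 - i) * y ^+ i)).
    by apply: cong_sum => i; apply: congM; [exact: congX | exact: cong_refl].
  exists (y ^+ p.-1); rewrite subr0.
  rewrite (eq_bigr (fun=> y ^+ p.-1)) ?sumr_const ?card_ord // => i _.
  by rewrite -exprD subnK //; case: p i {ab Dc xy x y} => [[]|p' [i]].
exists (c * d); rewrite subrXX Dc; rewrite subr0 in Dd; rewrite Dd.
by rewrite mulrnAl mulrnAr -mulrnA -expnS.
Qed.

Lemma cong_freshmanD p a b : prime p -> cong p ((a + b) ^+ p) (a ^+ p + b ^+ p).
Proof.
case: p => [//|q] q_pr; rewrite exprDn big_ord_recl big_ord_recr /=.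
rewrite subn0 subnn bin0 binn !expr0 mulr1 mul1r !mulr1n.
exists (\sum_(i < q) (a ^+ (q.+1 - i.+1) * b ^+ i.+1) *+ ('C(q.+1, i.+1) %/ q.+1)).
rewrite addrCA addrK -sumrMnl; apply: eq_bigr => i _.
by rewrite -mulrnA divnK ?prime_dvd_bin //= ltnS.
Qed.

Lemma cong_freshmanB p a b : prime p -> cong p ((a - b) ^+ p) (a ^+ p - b ^+ p).
Proof.
move=> p_pr; apply: cong_trans (cong_freshmanD _ _ p_pr) _.
apply: congD; first exact: cong_refl.
have := cong_freshmanD b (- b) p_pr; rewrite subrr expr0n -[p == 0]negbK -lt0n.
rewrite prime_gt0 //= => /cong_sym H.
have := congD H (cong_refl p (- (b ^+ p))).
by rewrite add0r addrAC subrr add0r.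
Qed.

End Cong.

Section Dwork.
Variables (p : nat) (p_pr : prime p).
Let p_gt0 : (0 < p)%N := prime_gt0 p_pr.

(* The n-th Witt polynomial, i.e. the n-th ghost component of x :             *)
(*   x_0 ^ (p^n) + p x_1 ^ (p^(n-1)) + ... + p^n x_n.                         *)
Definition ghost (B : comNzRingType) (x : nat -> B) (n : nat) : B :=
  \sum_(i < n.+1) x i ^+ (p ^ (n - i)) *+ p ^ i.

Lemma ghost_recr (B : comNzRingType) (x : nat -> B) n :
  ghost x n = \sum_(i < n) x i ^+ (p ^ (n - i)) *+ p ^ i + x n *+ p ^ n.
Proof. by rewrite /ghost big_ord_recr /= subnn expn0 expr1. Qed.

Lemma rmorph_ghost (A B : comNzRingType) (f : {rmorphism A -> B}) x n :
  f (ghost x n) = ghost (f \o x) n.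
Proof.
by rewrite rmorph_sum; apply: eq_bigr => i _; rewrite rmorphMn rmorphXn.
Qed.

Section Unghost.
Variable V : choiceType.
Implicit Types f g : zpoly V.

Lemma zpoly_mulIn m f g : (0 < m)%N -> f *+ m = g *+ m -> f = g.
Proof. by move=> m_gt0 /(congr1 (zdiv m)); rewrite !zdivK. Qed.

(* unghost F is the sequence u of integer polynomials whose ghost components  *)
(* are F, obtained by solving                                                 *)
(*   F n = \sum_(i < n) p^i u_i ^ (p^(n-i)) + p^n u_n                        *)
(* successively for u_0, u_1, ...; the divisions by p^n are exact when F      *)
(* satisfies Dwork's congruences (ghost_unghost).                             *)
Fixpoint unghost_seq (F : nat -> zpoly V) (n : nat) : seq (zpoly V) :=
  if n isn't n'.+1 then [::] else
  let s := unghost_seq F n' in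
  rcons s
    (zdiv (p ^ n') (F n' - \sum_(i < n') s`_i ^+ (p ^ (n' - i)) *+ p ^ i)).

Definition unghost F n : zpoly V := (unghost_seq F n.+1)`_n.

Lemma size_unghost_seq F n : size (unghost_seq F n) = n.
Proof. by elim: n => //= n IHn; rewrite size_rcons IHn. Qed.

Lemma nth_unghost_seq F n i : (i < n)%N -> (unghost_seq F n)`_i = unghost F i.
Proof.
elim: n => // n IHn; rewrite ltnS leq_eqVlt => /orP[/eqP -> //|lt_in].
by rewrite /= nth_rcons size_unghost_seq lt_in IHn.
Qed.

Lemma unghostE F n : unghost F n =
  zdiv (p ^ n) (F n - \sum_(i < n) unghost F i ^+ (p ^ (n - i)) *+ p ^ i).
Proof.
rewrite {1}/unghost /= nth_rcons size_unghost_seq ltnn eqxx.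
apply: (congr1 (fun f => zdiv (p ^ n) (F n - f))).
by apply: eq_bigr => i _; rewrite nth_unghost_seq.
Qed.

Definition zfrob : {rmorphism zpoly V -> zpoly V} :=
  zeval (fun v => zvar v ^+ p).

Lemma zfrob_cong f : cong p (zfrob f) (f ^+ p).
Proof.
elim/zpoly_ind: f => [|v|f g IHf IHg|f g IHf IHg].
- by rewrite rmorph1 expr1n; apply: cong_refl.
- by rewrite /zfrob zeval_var; apply: cong_refl.
- rewrite rmorphB; apply: cong_trans (cong_sym (cong_freshmanB _ _ p_pr)).
  exact: congD IHf (congN IHg).
- by rewrite rmorphM exprMn; exact: congM IHf IHg.
Qed.

Lemma zfrob_ghost_cong (u : nat -> zpoly V) n :
  cong (p ^ n.+1) (zfrob (ghost u n))
    (\sum_(i < n.+1) u i ^+ (p ^ (n.+1 - i)) *+ p ^ i).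
Proof.
rewrite rmorph_ghost; apply: cong_sum => i /=.
have le_in : (i <= n)%N by rewrite -ltnS.
have ->: (p ^ n.+1 = p ^ (n - i).+1 * p ^ i)%N by rewrite -expnD addSn subnK.
apply: congMn; rewrite subSn // [in X in cong _ _ X]expnS exprM.
by apply: cong_exp; apply: zfrob_cong.
Qed.

Definition dwork (F : nat -> zpoly V) :=
  forall n, cong (p ^ n.+1) (F n.+1) (zfrob (F n)).

Lemma ghost_unghost F : dwork F -> forall n, ghost (unghost F) n = F n.
Proof.
move=> dF n; elim: n => [|n IHn].
  rewrite ghost_recr big_ord0 add0r unghostE big_ord0 subr0 expn0.
  by rewrite -[X in zdiv _ X]mulr1n zdivK.
rewrite ghost_recr [unghost F n.+1]unghostE.
set S := \sum_(i < _) _; have [c Dc]: cong (p ^ n.+1) (F n.+1) S.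
  by apply: cong_trans (dF n) _; rewrite -IHn; apply: zfrob_ghost_cong.
by rewrite Dc zdivK ?expn_gt0 ?p_gt0 // -Dc addrC subrK.
Qed.

Lemma ghost_inj (u v : nat -> zpoly V) :
  (forall n, ghost u n = ghost v n) -> forall n, u n = v n.
Proof.
move=> uv n; have [m lenm] := ubnP n; elim: m n lenm => // m IHm n lenm.
apply: (@zpoly_mulIn (p ^ n)); first by rewrite expn_gt0 p_gt0.
have S: \sum_(i < n) u i ^+ (p ^ (n - i)) *+ p ^ i =
        \sum_(i < n) v i ^+ (p ^ (n - i)) *+ p ^ i.
  apply: eq_bigr => i _; rewrite IHm //.
  exact: leq_trans (ltn_ord i) lenm.
by have := uv n; rewrite !ghost_recr S => /addrI.
Qed.

Lemma dwork_ghost (x : nat -> V) : dwork (ghost (zvar \o x)).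
Proof.
move=> n; apply: cong_sym; exists (- zvar (x n.+1)).
rewrite rmorph_ghost [ghost _ n.+1]ghost_recr opprD addrA.
suff ->: ghost (zfrob \o (zvar \o x)) n =
    \sum_(i < n.+1) (zvar \o x) i ^+ (p ^ (n.+1 - i)) *+ p ^ i.
  by rewrite subrr sub0r mulNrn.
apply: eq_bigr => i _ /=.
by rewrite /zfrob zeval_var -exprM -expnS -subSn // -ltnS.
Qed.

Lemma dworkD F G : dwork F -> dwork G -> dwork (fun n => F n + G n).
Proof. by move=> dF dG n; rewrite rmorphD; apply: congD. Qed.

Lemma dworkN F : dwork F -> dwork (fun n => - F n).
Proof. by move=> dF n; rewrite rmorphN; apply: congN. Qed.

Lemma dworkM F G : dwork F -> dwork G -> dwork (fun n => F n * G n).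
Proof. by move=> dF dG n; rewrite rmorphM; apply: congM. Qed.

End Unghost.
End Dwork.

Section WittPolynomials.
Variable p : nat.

Let X (n : nat) : zpoly (bool * nat)%type := zvar (false, n).
Let Y (n : nat) : zpoly (bool * nat)%type := zvar (true, n).

(* The universal polynomials S_n, P_n and I_n giving the n-th coordinate of   *)
(* the sum, product and opposite of Witt vectors.                             *)
Definition witt_add_poly := unghost p (fun n => ghost p X n + ghost p Y n).
Definition witt_mul_poly := unghost p (fun n => ghost p X n * ghost p Y n).
Definition witt_opp_poly := unghost p (fun n => - ghost p X n).

End WittPolynomials.

(* p-typical Witt vectors (x_0, x_1, ...) over A. The proof that p is prime   *)
(* only serves to index the ring structure on this type.                      *)
Record witt (p : nat) (p_pr : prime p) (A : comNzRingType) :=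
  Witt { wcoord :> nat -> A }.
Arguments Witt {p} p_pr {A} _.

Section WittOps.
Variables (p : nat) (p_pr : prime p).
Let p_gt0 : (0 < p)%N := prime_gt0 p_pr.
Local Notation W := (witt p_pr).

Lemma wcoordP (A : comNzRingType) (x y : W A) : (forall n, x n = y n) -> x = y.
Proof. by case: x y => [x] [y] /= xy; congr Witt; apply/funext. Qed.

Section Ops.
Variable A : comNzRingType.
Implicit Types x y z : W A.

Definition witt_val x y (v : bool * nat) : A := if v.1 then y v.2 else x v.2.

Definition witt0 : W A := Witt p_pr (fun=> 0).
Definition witt1 : W A := Witt p_pr (fun n => (n == 0%N)%:R).
Definition witt_add x y : W A :=
  Witt p_pr (fun n => zeval (witt_val x y) (witt_add_poly p n)).
Definition witt_mul x y : W A :=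
  Witt p_pr (fun n => zeval (witt_val x y) (witt_mul_poly p n)).
Definition witt_opp x : W A :=
  Witt p_pr (fun n => zeval (witt_val x x) (witt_opp_poly p n)).

Lemma zeval_witt_val x y n :
  (zeval (witt_val x y) (ghost p (zvar \o pair false) n) = ghost p x n) *
  (zeval (witt_val x y) (ghost p (zvar \o pair true) n) = ghost p y n).
Proof.
by split; rewrite rmorph_ghost; apply: eq_bigr => i _; rewrite /= zeval_var.
Qed.

Lemma ghost_witt_add x y n :
  ghost p (witt_add x y) n = ghost p x n + ghost p y n.
Proof.
rewrite -(rmorph_ghost p (zeval (witt_val x y)) (witt_add_poly p)).
rewrite ghost_unghost // ?rmorphD; last by apply: dworkD; apply: dwork_ghost.
by rewrite !zeval_witt_val.
Qed.

Lemma ghost_witt_mul x y n :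
  ghost p (witt_mul x y) n = ghost p x n * ghost p y n.
Proof.
rewrite -(rmorph_ghost p (zeval (witt_val x y)) (witt_mul_poly p)).
rewrite ghost_unghost // ?rmorphM; last by apply: dworkM; apply: dwork_ghost.
by rewrite !zeval_witt_val.
Qed.

Lemma ghost_witt_opp x n : ghost p (witt_opp x) n = - ghost p x n.
Proof.
rewrite -(rmorph_ghost p (zeval (witt_val x x)) (witt_opp_poly p)).
rewrite ghost_unghost // ?rmorphN; last by apply: dworkN; apply: dwork_ghost.
by rewrite !zeval_witt_val.
Qed.

Lemma ghost_witt0 n : ghost p witt0 n = 0.
Proof.
by apply: big1 => i _; rewrite /= expr0n expn_eq0 -[p == 0%N]negbK -lt0n p_gt0 mul0rn.
Qed.

Lemma ghost_witt1 n : ghost p witt1 n = 1.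
Proof.
rewrite /ghost big_ord_recl /= expr1n big1 ?addr0 // => i _.
by rewrite /= expr0n expn_eq0 -[p == 0%N]negbK -lt0n p_gt0 mul0rn.
Qed.

End Ops.

Definition ghostE := (ghost_witt_add, ghost_witt_mul, ghost_witt_opp,
  ghost_witt0, ghost_witt1).

Lemma witt_ghost_inj (V : choiceType) (x y : W (zpoly V)) :
  (forall n, ghost p x n = ghost p y n) -> x = y.
Proof. by move=> xy; apply/wcoordP/(ghost_inj p_pr). Qed.

Section Map.
Variables (A B : comNzRingType) (f : {rmorphism A -> B}).

Definition witt_map (x : W A) : W B := Witt p_pr (f \o x).

Lemma rmorph_zeval (V : choiceType) (e : V -> A) (g : zpoly V) :
  f (zeval e g) = zeval (f \o e) g.
Proof.
elim/zpoly_ind: g => [|v|g h IHg IHh|g h IHg IHh].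
- by rewrite !rmorph1.
- by rewrite !zeval_var.
- by rewrite !rmorphB IHg IHh.
- by rewrite !rmorphM IHg IHh.
Qed.

Lemma witt_val_map x y :
  f \o witt_val x y = witt_val (witt_map x) (witt_map y).
Proof. by apply/funext => -[[] n]. Qed.

Lemma witt_map_add x y :
  witt_map (witt_add x y) = witt_add (witt_map x) (witt_map y).
Proof. by apply: wcoordP => n /=; rewrite rmorph_zeval witt_val_map. Qed.

Lemma witt_map_mul x y :
  witt_map (witt_mul x y) = witt_mul (witt_map x) (witt_map y).
Proof. by apply: wcoordP => n /=; rewrite rmorph_zeval witt_val_map. Qed.

Lemma witt_map_opp x : witt_map (witt_opp x) = witt_opp (witt_map x).
Proof. by apply: wcoordP => n /=; rewrite rmorph_zeval witt_val_map. Qed.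

Lemma witt_map0 : witt_map (witt0 A) = witt0 B.
Proof. by apply: wcoordP => n /=; rewrite rmorph0. Qed.

Lemma witt_map1 : witt_map (witt1 A) = witt1 B.
Proof. by apply: wcoordP => n /=; rewrite rmorph_nat. Qed.

End Map.

Definition witt_mapE := (witt_map_add, witt_map_mul, witt_map_opp,
  witt_map0, witt_map1).

(* Universal Witt vectors: as Z[X] has no p-torsion, its Witt vectors embed   *)
(* into ghost components, so the ring axioms hold for the wgen j; they        *)
(* specialise to arbitrary Witt vectors.                                      *)
Definition wgen (j : nat) : W (zpoly (nat * nat)%type) :=
  Witt p_pr (fun n => zvar (j, n)).

Section WittRing.
Variable A : comNzRingType.
Implicit Types x y z : W A.

Definition wspec (s : seq (W A)) :=
  witt_map (zeval (fun v => nth (witt0 A) s v.1 v.2)).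

Lemma wspecE s j : wspec s (wgen j) = nth (witt0 A) s j.
Proof. by apply: wcoordP => n /=; rewrite zeval_var. Qed.

Lemma witt_addA : associative (@witt_add A).
Proof.
move=> x y z; have /(congr1 (wspec [:: x; y; z])) :
  witt_add (wgen 0) (witt_add (wgen 1) (wgen 2)) =
  witt_add (witt_add (wgen 0) (wgen 1)) (wgen 2).
  by apply: witt_ghost_inj => n; rewrite !ghostE addrA.
by rewrite /wspec !witt_mapE -/(wspec _) !wspecE.
Qed.

Lemma witt_addC : commutative (@witt_add A).
Proof.
move=> x y; have /(congr1 (wspec [:: x; y])) :
  witt_add (wgen 0) (wgen 1) = witt_add (wgen 1) (wgen 0).
  by apply: witt_ghost_inj => n; rewrite !ghostE addrC.
by rewrite /wspec !witt_mapE -/(wspec _) !wspecE.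
Qed.

Lemma witt_add0 : left_id (witt0 A) (@witt_add A).
Proof.
move=> x; have /(congr1 (wspec [:: x])) : witt_add (witt0 _) (wgen 0) = wgen 0.
  by apply: witt_ghost_inj => n; rewrite !ghostE add0r.
by rewrite /wspec !witt_mapE -/(wspec _) !wspecE.
Qed.

Lemma witt_addN : left_inverse (witt0 A) (@witt_opp A) (@witt_add A).
Proof.
move=> x; have /(congr1 (wspec [:: x])) :
  witt_add (witt_opp (wgen 0)) (wgen 0) = witt0 _.
  by apply: witt_ghost_inj => n; rewrite !ghostE addNr.
by rewrite /wspec !witt_mapE -/(wspec _) !wspecE.
Qed.

Lemma witt_mulA : associative (@witt_mul A).
Proof.
move=> x y z; have /(congr1 (wspec [:: x; y; z])) :
  witt_mul (wgen 0) (witt_mul (wgen 1) (wgen 2)) =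
  witt_mul (witt_mul (wgen 0) (wgen 1)) (wgen 2).
  by apply: witt_ghost_inj => n; rewrite !ghostE mulrA.
by rewrite /wspec !witt_mapE -/(wspec _) !wspecE.
Qed.

Lemma witt_mulC : commutative (@witt_mul A).
Proof.
move=> x y; have /(congr1 (wspec [:: x; y])) :
  witt_mul (wgen 0) (wgen 1) = witt_mul (wgen 1) (wgen 0).
  by apply: witt_ghost_inj => n; rewrite !ghostE mulrC.
by rewrite /wspec !witt_mapE -/(wspec _) !wspecE.
Qed.

Lemma witt_mul1 : left_id (witt1 A) (@witt_mul A).
Proof.
move=> x; have /(congr1 (wspec [:: x])) : witt_mul (witt1 _) (wgen 0) = wgen 0.
  by apply: witt_ghost_inj => n; rewrite !ghostE mul1r.
by rewrite /wspec !witt_mapE -/(wspec _) !wspecE.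
Qed.

Lemma witt_mulDl : left_distributive (@witt_mul A) (@witt_add A).
Proof.
move=> x y z; have /(congr1 (wspec [:: x; y; z])) :
  witt_mul (witt_add (wgen 0) (wgen 1)) (wgen 2) =
  witt_add (witt_mul (wgen 0) (wgen 2)) (witt_mul (wgen 1) (wgen 2)).
  by apply: witt_ghost_inj => n; rewrite !ghostE mulrDl.
by rewrite /wspec !witt_mapE -/(wspec _) !wspecE.
Qed.

Lemma witt1_neq0 : witt1 A <> witt0 A.
Proof.
by move=> /(congr1 (fun x : W A => x 0%N)) /= /eqP; rewrite oner_eq0.
Qed.

End WittRing.

HB.instance Definition _ (A : comNzRingType) := gen_eqMixin (W A).
HB.instance Definition _ (A : comNzRingType) := gen_choiceMixin (W A).
HB.instance Definition _ (A : comNzRingType) := GRing.isZmodule.Build (W A)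
  (@witt_addA A) (@witt_addC A) (@witt_add0 A) (@witt_addN A).
Lemma witt_nontrivial (A : comNzRingType) : witt1 A != 0 :> W A.
Proof. by apply/eqP/witt1_neq0. Qed.
HB.instance Definition _ (A : comNzRingType) :=
  GRing.Zmodule_isComNzRing.Build (W A) (@witt_mulA A) (@witt_mulC A)
    (@witt_mul1 A) (@witt_mulDl A) (@witt_nontrivial A).

Section Residue.
Variable A : comNzRingType.

Definition witt_res (x : W A) : A := x 0%N.

Lemma ghost0 (x : W A) : ghost p x 0 = witt_res x.
Proof. by rewrite ghost_recr big_ord0 add0r expn0. Qed.

Lemma witt_res_is_zmod_morphism : zmod_morphism witt_res.
Proof.
by move=> x y; rewrite -!ghost0 ghost_witt_add ghost_witt_opp.
Qed.
Lemma witt_res_is_monoid_morphism : monoid_morphism witt_res.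
Proof. by split=> // x y; rewrite -!ghost0 ghost_witt_mul. Qed.
HB.instance Definition _ :=
  GRing.isZmodMorphism.Build (W A) A witt_res witt_res_is_zmod_morphism.
HB.instance Definition _ :=
  GRing.isMonoidMorphism.Build (W A) A witt_res witt_res_is_monoid_morphism.

End Residue.
End WittOps.

Section WittCyclo.
Variables (k : closedFieldType) (p : nat) (charkp : p \in [pchar k]) (h : nat).
Let p_pr : prime p := pcharf_prime charkp.
Local Notation W := (witt (pcharf_prime charkp) k).
Local Notation res := (@witt_res p (pcharf_prime charkp) k).

(* For q = p^h, the cyclotomic polynomial 'Phi_q remains irreducible over     *)
(* W(k), being Eisenstein in 'X - 1, so that W(k)[zeta_q] is W(k)['X]/'Phi_q. *)
Definition wPhi : {poly W} := map_poly intr 'Phi_(p ^ h).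

Lemma wPhi_monic : wPhi \is monic.
Proof. exact/monic_map/Cyclotomic_monic. Qed.

Lemma size_wPhi : size wPhi = (totient (p ^ h)).+1.
Proof.
rewrite -size_Cyclotomic size_poly_eq // -lead_coefE.
by rewrite (monicP (Cyclotomic_monic _)) oner_eq0.
Qed.

(* {poly %/ f} is the quotient by mk_monic f; here this is f itself. *)
Lemma mk_monic_wPhi : mk_monic wPhi = wPhi.
Proof.
by rewrite /mk_monic wPhi_monic size_wPhi ltnS totient_gt0 expn_gt0 prime_gt0.
Qed.

Definition witt_cyclo : Type := {poly %/ wPhi}.

HB.instance Definition _ := GRing.ComNzRing.on witt_cyclo.

Definition wcyclo_unit (x : witt_cyclo) := `[< exists y, y * x = 1 >].

Definition wcyclo_inv (x : witt_cyclo) : witt_cyclo :=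
  if pselect (exists y, y * x = 1) is left ex then projT1 (cid ex) else x.

Lemma wcyclo_mulVr : {in wcyclo_unit, left_inverse 1 wcyclo_inv *%R}.
Proof.
move=> x /asboolP ux; rewrite /wcyclo_inv; case: pselect => // ex.
exact: projT2 (cid ex).
Qed.

Lemma wcyclo_unitP (x y : witt_cyclo) : y * x = 1 -> wcyclo_unit x.
Proof. by move=> yx1; apply/asboolP; exists y. Qed.

Lemma wcyclo_invr_out : {in [predC wcyclo_unit], wcyclo_inv =1 id}.
Proof.
move=> x /asboolPn ux; rewrite /wcyclo_inv; by case: pselect.
Qed.

HB.instance Definition _ := GRing.ComNzRing_hasMulInverse.Build witt_cyclo
  wcyclo_mulVr wcyclo_unitP wcyclo_invr_out.

Definition zeta : witt_cyclo := in_qpoly wPhi 'X.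

(* The residue map witt_cyclo -> k: it is x |-> x_0 on W(k), and it maps zeta *)
(* to 1, the only q-th root of unity in k.                                    *)
Definition reduction (r : witt_cyclo) : k :=
  (map_poly res (val r)).[1].

Lemma res_wPhi : map_poly res wPhi = map_poly intr 'Phi_(p ^ h).
Proof.
by rewrite -map_poly_comp; apply: eq_map_poly => z /=; rewrite rmorph_int.
Qed.

Lemma res_wPhi1 : (map_poly res wPhi).[1] = 0.
Proof.
rewrite res_wPhi; set f := map_poly _ _.
have q_gt0 : (0 < p ^ h)%N by rewrite expn_gt0 prime_gt0.
have f_monic : f \is monic by exact/monic_map/Cyclotomic_monic.
have /closed_rootP[z fz]: size f != 1%N.
  rewrite size_poly_eq -?lead_coefE ?(monicP (Cyclotomic_monic _)) ?oner_eq0 //.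
  by rewrite size_Cyclotomic eqSS -lt0n totient_gt0.
have: (map_poly intr ('X^(p ^ h) - 1 : {poly int}) : {poly k}).[z] = 0.
  rewrite -prod_Cyclotomic // (big_rem (p ^ h)%N) /= ?divisors_id //.
  by rewrite rmorphM hornerM (rootP fz) mul0r.
rewrite rmorphB rmorph1 /= map_polyXn !hornerE.
have ->: z ^+ (p ^ h) - 1 = (z - 1) ^+ (p ^ h).
  elim: (h) => [|n IHn]; first by rewrite expn0 !expr1.
  rewrite expnSr !exprM -IHn -!(pFrobenius_autE charkp).
  by rewrite rmorphB rmorph1.
by move/eqP; rewrite expf_eq0 q_gt0 subr_eq0 => /eqP <-; exact/rootP.
Qed.

Lemma reduction_in_qpoly (f : {poly W}) :
  reduction (in_qpoly wPhi f) = (map_poly res f).[1].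
Proof.
rewrite /reduction /= mk_monic_wPhi.
rewrite [in RHS](Pdiv.RingMonic.rdivp_eq wPhi_monic f).
by rewrite rmorphD rmorphM hornerD hornerM res_wPhi1 mulr0 add0r.
Qed.

Lemma reduction_zeta : reduction zeta = 1.
Proof. by rewrite reduction_in_qpoly map_polyX hornerX. Qed.

Lemma reduction_is_zmod_morphism : zmod_morphism reduction.
Proof. by move=> r s; rewrite /reduction !rmorphB /= hornerD hornerN. Qed.

Lemma reduction_is_monoid_morphism : monoid_morphism reduction.
Proof.
split=> [|r s].
  have ->: 1 = in_qpoly wPhi 1 :> witt_cyclo by rewrite in_qpoly1.
  by rewrite reduction_in_qpoly rmorph1 hornerC.
rewrite -[r * s]/(in_qpoly wPhi (val r * val s)) reduction_in_qpoly.
by rewrite rmorphM hornerM.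
Qed.

HB.instance Definition _ :=
  GRing.isZmodMorphism.Build witt_cyclo k reduction reduction_is_zmod_morphism.
HB.instance Definition _ :=
  GRing.isMonoidMorphism.Build witt_cyclo k reduction
    reduction_is_monoid_morphism.

Definition is_lift (gT : finGroupType) (G : {group gT}) (n : nat)
    (rhoR : mx_representation witt_cyclo G n) (rho : mx_representation k G n) :=
  {in G, forall g, map_mx reduction (rhoR g) = rho g}.

End WittCyclo.

(* Main.v *)
Require Import Defs.
From mathcomp Require Import all_boot all_order all_algebra.
From mathcomp Require Import all_fingroup all_solvable all_field all_character.
From mathcomp Require Import ring.

(** The witness is the group C_p x| C_m inside GL_2(F_p) generated by the
    transvection tau = [[1, 1], [0, 1]] and sigma = diag(2, 1), where m is the
    order of 2 modulo p, together with its inclusion in GL_2(k). Conjugation by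
    sigma squares tau.

    Suppose that T, S lift tau, sigma to a commutative ring R. Heuristically,
    the two eigenvalues of T are p-th roots of unity, and squaring permutes
    them: an eigenvalue z satisfies z^2 = z, or z^4 = z, so that its order
    divides 3 as well as p. As p > 3 both eigenvalues are 1, and a unipotent
    matrix of finite order over a ring of characteristic zero is the identity,
    whereas T reduces to tau.

    The proof replaces eigenvalues by traces, so as not to rely on R being a
    domain. As T and T^2 are conjugate, \det T = 1 and the trace t of T
    satisfies t = \tr (T^2) = t^2 - 2; then \tr (T^n) depends only on n modulo 3
    and takes the values 2, t, t. Comparing with T^p = 1 yields t = 2, so
    N = T - 1 has square zero by Cayley-Hamilton (unipotent_of_conj_sqr), and
    1 = (1 + N)^p = 1 + p N shows that p kills N.

    What remains of characteristic zero is that p-torsion in R = W(k)[zeta]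
    reduces to 0 in k (reduction_ptorsion). Modulo the cyclotomic polynomial
    this is a coefficientwise statement about W(k), and follows from
    (p x)_1 = x_0^p there. Hence T reduces to 1, contradicting that its
    upper right entry reduces to 1. *)

Set Implicit Arguments.
Unset Strict Implicit.
Unset Printing Implicit Defensive.

Import GRing.Theory.
Local Open Scope ring_scope.

Lemma expr1D_sqr0 (A : pzRingType) (x : A) n :
  x ^+ 2 = 0 -> (1 + x) ^+ n = 1 + x *+ n.
Proof.
move=> x2; elim: n => [|n IHn]; first by rewrite expr0 addr0.
rewrite exprS IHn mulrDl mul1r mulrDr mulr1 mulrnAr -expr2 x2 mul0rn addr0.
by rewrite -addrA -mulrSr.
Qed.

Section Matrices2.
Variable A : comNzRingType.
Implicit Types T S : 'M[A]_2.

Lemma sqr_mx2 T : T ^+ 2 = \tr T *: T - (\det T)%:M.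
Proof.
have Dchar : char_poly T = 'X^2 - \tr T *: 'X + (\det T)%:P.
  have sz := size_char_poly T; have := monicP (char_poly_monic T).
  rewrite lead_coefE sz /= => c2.
  have c1 : (char_poly T)`_1 = - \tr T by exact: (@char_poly_trace _ 2).
  have c0 := char_poly_det T; rewrite sqrrN expr1n mul1r in c0.
  apply/polyP => -[|[|[|i]]]; rewrite coefD coefB coefZ coefXn coefX coefC /=.
  - by rewrite mulr0 subr0 add0r.
  - by rewrite mulr1 sub0r addr0.
  - by rewrite mulr0 subr0 addr0.
  - by rewrite nth_default ?sz // mulr0 subr0 addr0.
have := Cayley_Hamilton T.
rewrite Dchar -mul_polyC !expr2 rmorphD rmorphB !rmorphM /=.
rewrite horner_mx_X !horner_mx_C -[_%:M * T]/(_%:M *m T) mul_scalar_mx => /eqP.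
by rewrite -addrA addr_eq0 opprD opprK => /eqP.
Qed.

Lemma mxtrace_expr2 T n :
  \tr (T ^+ n.+2) = \tr T * \tr (T ^+ n.+1) - \det T * \tr (T ^+ n).
Proof.
have -> : T ^+ n.+2 = T ^+ n * T ^+ 2 by rewrite -exprD addn2.
rewrite sqr_mx2 mulrBr raddfB /= -scalerAr -exprSr linearZ /=.
by rewrite -scalemx1 -scalerAr mulr1 linearZ.
Qed.

(** Over a field the eigenvalues of T are n-th roots of unity permuted by
    squaring, so they are cube roots of unity, hence 1 as n is prime to 3.
    Over a ring, the traces of the powers of T carry the same information:
    they form a sequence of period 3. *)
Lemma unipotent_of_conj_sqr T S S' n : (0 < n)%N -> coprime n 3 ->
  S' *m S = 1%:M -> S *m T *m S' = T ^+ 2 -> T ^+ n = 1 ->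
  (T - 1) ^+ 2 = 0.
Proof.
move=> n_gt0 co_n3 S'S TS Tn.
have trT2 : \tr (T ^+ 2) = \tr T.
  by rewrite -TS -mulmxA mxtrace_mulC -mulmxA S'S mulmx1.
(* The determinant is idempotent, and its n-th power is 1. *)
have detT : \det T = 1.
  have det_idem : \det T * \det T = \det T.
    transitivity (\det (T ^+ 2)); first by rewrite expr2 det_mulmx.
    have detS : \det S * \det S' = 1.
      by rewrite mulrC -det_mulmx S'S det1.
    by rewrite -TS !det_mulmx mulrAC detS mul1r.
  have detX m : \det (T ^+ m.+1) = \det T.
    elim: m => [|m IHm]; first by rewrite expr1.
    by rewrite exprS det_mulmx IHm.
  by case: n n_gt0 Tn {co_n3} => // n _ Tn; rewrite -(detX n) Tn det1.
have trXSS m : \tr (T ^+ m.+2) = \tr T * \tr (T ^+ m.+1) - \tr (T ^+ m).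
  by rewrite mxtrace_expr2 detT mul1r.
have trX0 : \tr (T ^+ 0) = 2 by rewrite expr0 mxtrace1.
have sqr_tr : \tr T * \tr T = \tr T + 2.
  have := trXSS 0; rewrite trT2 trX0 expr1 => E.
  by rewrite [X in X + _]E subrK.
have period3 m : [/\ \tr (T ^+ (m * 3)) = 2, \tr (T ^+ (m * 3).+1) = \tr T
                   & \tr (T ^+ (m * 3).+2) = \tr T].
  elim: m => [|m [IH0 IH1 IH2]]; first by rewrite mul0n trX0 expr1.
  have E0 : \tr (T ^+ (m.+1 * 3)) = 2.
    by rewrite mulSn trXSS IH1 IH2 sqr_tr; ring.
  have E1 : \tr (T ^+ (m.+1 * 3).+1) = \tr T.
    by rewrite trXSS E0 IH2; ring.
  by split=> //; rewrite trXSS E1 E0 sqr_tr; ring.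
have trT : \tr T = 2.
  have <- : \tr (T ^+ n) = 2 by rewrite Tn mxtrace1.
  have [P0 P1 P2] := period3 (n %/ 3)%N.
  have : (n %% 3 < 3)%N by rewrite ltn_mod.
  rewrite [X in T ^+ X](divn_eq n 3).
  case Dr: (n %% 3)%N => [|[|[|//]]] _; rewrite ?addn0 ?addn1 ?addn2 ?P1 ?P2 //.
  by move: co_n3; rewrite -coprime_modl Dr.
rewrite sqrrB1 sqr_mx2 trT detT scaler_nat -[1%:M]/(1 : 'M_2).
by rewrite addrAC subrK subrr.
Qed.

End Matrices2.

Section WittTorsion.
Variables (p : nat) (p_pr : prime p).

(** The second ghost component of p x, divided by p, reads
    p^(p-1) x_0^p + (p x)_1 = x_0^p + p x_1. Dividing by p is legitimate
    because integer polynomials have no torsion. *)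
Lemma cong_wcoord1_Mp (V : choiceType) (x : witt p_pr (zpoly V)) :
  cong p ((x *+ p) 1) (x 0 ^+ p).
Proof.
have ghMn n i : ghost p (x *+ n) i = ghost p x i *+ n.
  elim: n => [|n IHn]; first by rewrite mulr0n ghost_witt0.
  by rewrite !mulrS ghost_witt_add IHn.
have c0 : (x *+ p) 0 = x 0 *+ p by have := ghMn p 0%N; rewrite !ghost0.
have := ghMn p 1%N.
rewrite !ghost_recr !big_ord1 !subn0 !expn0 !expn1 !mulr1n c0.
rewrite exprMn_n mulrnDl => gh1.
exists (x 1 - x 0 ^+ p *+ p ^ p.-2).
apply: (zpoly_mulIn (prime_gt0 p_pr)).
have Dpp : (p ^ p = p ^ p.-2 * p * p)%N.
  by rewrite -!expnSr; congr (_ ^ _)%N; case: (p) (prime_gt1 p_pr) => [|[]].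
rewrite !mulrnBl -!mulrnA mulnA -Dpp mulrnA (canRL (addKr _) gh1).
by rewrite addrCA addrAC subrr add0r addrC.
Qed.

(** The coordinate of index 1 in the identity p = V F of characteristic p; it
    is obtained by specialising the universal Witt vector. *)
Lemma wcoord1_Mp (A : comNzRingType) (x : witt p_pr A) :
  p \in [pchar A] -> (x *+ p) 1 = x 0 ^+ p.
Proof.
move=> charAp.
pose f := zeval (fun v : nat * nat => nth (witt0 p_pr A) [:: x] v.1 v.2).
have fE : witt_map f (wgen p_pr 0) = x by exact: wspecE.
have fMn n : witt_map f (wgen p_pr 0 *+ n) = x *+ n.
  elim: n => [|n IHn]; first by rewrite !mulr0n witt_map0.
  by rewrite !mulrS witt_map_add IHn fE.
have [c /(congr1 f)] := cong_wcoord1_Mp (wgen p_pr 0).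
rewrite rmorphB rmorphMn -mulr_natr (pcharf0 charAp) mulr0 => /eqP.
rewrite subr_eq0 rmorphXn => /eqP.
rewrite -[f _]/(witt_map f _ 1%N) -[f _ in RHS]/(witt_map f _ 0%N).
by rewrite fMn fE.
Qed.

End WittTorsion.

(** A weak form of the fact that W(k)[zeta] has no p-torsion: it only takes
    the leading Witt coordinates of the coefficients of r to vanish. *)
Lemma reduction_ptorsion (k : closedFieldType) (p : nat)
    (charkp : p \in [pchar k]) (h : nat) (r : witt_cyclo charkp h) :
  r *+ p = 0 -> reduction r = 0.
Proof.
move=> rp0.
have c0 i : (val r)`_i 0%N = 0.
  apply/eqP; have : (0 < p)%N && ((val r)`_i 0%N == 0).
    rewrite -expf_eq0 -wcoord1_Mp // -coefMn.
    have /(congr1 val) := rp0; rewrite raddfMn => /= ->.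
    by rewrite coef0.
  by case/andP.
rewrite /reduction.
have -> : map_poly (@witt_res p (pcharf_prime charkp) k) (val r) = 0.
  by apply/polyP => i; rewrite coef_map coef0 /= /witt_res c0.
by rewrite horner0.
Qed.

Section AffineGroup.
Variables (p : nat) (p_pr : prime p).

Definition transvection : 'M['F_p]_2 := 1 + delta_mx 0 1.
Definition dilation2 : 'M['F_p]_2 := diag_mx (\row_i if i == 0 then 2 else 1).

Lemma transvectionX n : transvection ^+ n = 1 + delta_mx 0 1 *+ n.
Proof. by apply: expr1D_sqr0; exact: mul_delta_mx_0. Qed.

Lemma transvectionXp : transvection ^+ p = 1.
Proof.
by rewrite transvectionX -scaler_nat (pcharf0 (pchar_Fp p_pr)) scale0r addr0.
Qed.

Lemma dilation2Xp1 : (2 < p)%N -> dilation2 ^+ p.-1 = 1.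
Proof.
move=> p_gt2.
have DX n : dilation2 ^+ n = diag_mx (\row_i if i == 0 then 2 ^+ n else 1).
  elim: n => [|n IHn].
    rewrite expr0 -[LHS]/(1%:M) -diag_const_mx; congr diag_mx.
    by apply/rowP => i; rewrite !mxE if_same.
  rewrite exprS IHn -[LHS]/(_ *m _) mulmx_diag; congr diag_mx.
  by apply/rowP => i; rewrite !mxE; case: eqP; rewrite ?mulr1 ?exprS.
rewrite DX -[RHS]/(1%:M) -diag_const_mx; congr diag_mx.
have F2 : 2 != 0 :> 'F_p.
  by rewrite -(dvdn_pcharf (pchar_Fp p_pr)) gtnNdvd.
apply/rowP => i; rewrite !mxE; case: eqP => // _.
apply: (mulfI F2); rewrite mulr1 -exprS prednK ?prime_gt0 //.
by have := expf_card (2 : 'F_p); rewrite card_Fp.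
Qed.

Lemma dilation2_transvection :
  dilation2 * transvection = transvection ^+ 2 * dilation2.
Proof.
rewrite transvectionX -[LHS]/(_ *m _) -[RHS]/(_ *m _) mul_diag_mx mul_mx_diag.
apply/matrixP => i j; rewrite !mxE.
by case: i j => [[|[|//]] ?] [[|[|//]] ?] /=; rewrite ?mulr0n ?mulr1n; ring.
Qed.

End AffineGroup.

Theorem proposition15 (k : closedFieldType) (p : nat)
    (charkp : p \in [pchar k]) (p_gt3 : (3 < p)%N) :
  exists (m h a : nat) (gT : finGroupType) (G : {group gT}) (sigma tau : gT),
    [/\ coprime m p,
        #[sigma]%g = m,
        #[tau]%g = (p ^ h)%N,
        (<[tau]> ><| <[sigma]> = G)%g &
        (sigma * tau * sigma^-1 = tau ^+ a)%g] /\
    exists rho : mx_representation k G 2,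
      ~ exists rhoR : mx_representation (witt_cyclo charkp h) G 2,
          is_lift rhoR rho.
Proof.
have p_pr := pcharf_prime charkp.
have uE : transvection p \is a GRing.unit.
  by rewrite -(unitrX_pos _ (prime_gt0 p_pr)) transvectionXp ?unitr1.
have uD : dilation2 p \is a GRing.unit.
  have p1_gt0 : (0 < p.-1)%N by case: (p) p_gt3 => [|[]].
  by rewrite -(unitrX_pos _ p1_gt0) dilation2Xp1 ?unitr1 // ltnW.
pose tau : {'GL_2(p)} := FinRing.Unit uE.
pose sigma : {'GL_2(p)} := FinRing.Unit uD.
have nt_tau : tau != 1%g.
  apply/eqP => /(congr1 val) /= /(canRL (addKr _)) /matrixP/(_ 0 1).
  by rewrite !mxE /= => /eqP; rewrite addNr oner_eq0.
have taup : (tau ^+ p)%g = 1%g.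
  by apply: val_inj; rewrite [LHS]FinRing.val_unitX /= transvectionXp.
have o_tau : #[tau]%g = p by apply: nt_prime_order.
have sigmap : (sigma ^+ p.-1)%g = 1%g.
  by apply: val_inj; rewrite [LHS]FinRing.val_unitX /= dilation2Xp1 // ltnW.
have co_sigma : coprime #[sigma]%g p.
  apply: (@coprime_dvdl _ p.-1); first by rewrite order_dvdn sigmap.
  by rewrite coprime_sym coprimenP ?prime_gt0.
have conj : (sigma * tau * sigma^-1 = tau ^+ 2)%g.
  apply: (canLR (mulgK _)); apply: val_inj.
  rewrite [LHS]FinRing.val_unitM [RHS]FinRing.val_unitM.
  by rewrite [val (tau ^+ 2)%g]FinRing.val_unitX /= dilation2_transvection.
pose G := (<[tau]> <*> <[sigma]>)%G.
exists #[sigma]%g, 1%N, 2, _, G, sigma, tau; split.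
  split=> //; apply: sdprodEY; last first.
    by apply: coprime_TIg; rewrite coprime_sym -!orderE o_tau.
  rewrite cycle_subG -groupV; apply/normP/eqP.
  rewrite eqEcard cardJg leqnn andbT -genJ conjg_set1 gen_subG sub1set.
  by rewrite conjgE invgK mulgA conj mem_cycle.
have Gtau : tau \in G by rewrite mem_gen // inE cycle_id.
have Gsigma : sigma \in G by rewrite mem_gen // inE cycle_id orbT.
(* The field k viewed as an 'F_p-algebra provides the embedding of 'F_p in k. *)
pose rho : mx_representation k G 2 :=
  subg_repr (map_repr (in_alg (pPrimeCharType charkp)) (GLrepr 'F_p 1))
    (subsetT G).
exists rho => -[rhoR lift].
pose T := rhoR tau.
have Tp : T ^+ p = 1 by rewrite -repr_mxX // taup repr_mx1.
have nT : (T - 1) ^+ 2 = 0.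
  apply: (@unipotent_of_conj_sqr _ _ (rhoR sigma) (rhoR sigma^-1%g) p) => //.
  - exact: prime_gt0.
  - by rewrite prime_coprime // gtnNdvd.
  - by rewrite -repr_mxM ?groupV // mulVg repr_mx1.
  - by rewrite -!repr_mxM ?groupV ?groupM // conj repr_mxX.
have pT : (T - 1) *+ p = 0.
  by apply: (addrI 1); rewrite -expr1D_sqr0 // addrC subrK Tp addr0.
have : reduction ((T - 1) 0 1) = 0.
  by apply: reduction_ptorsion; rewrite -mulmxnE pT mxE.
rewrite !mxE subr0; have := lift _ Gtau; move/matrixP/(_ 0 1); rewrite mxE => ->.
rewrite /rho /= /map_repr_mx !mxE /= add0r scale1r => /eqP.
by rewrite oner_eq0.
Qed.
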